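(* Let $r\ge 1$ be an integer, and let $G$ be a connected graph of order $n\ge 4(r+1)(r+2)$ with minimum degree $\delta(G)\ge r$. If $\lambda(G)\ge\lambda(F_n^{r})$, then $G$ has a fractional $r$-factor, unless $G\cong F_n^{r}$.
   Context: $\lambda(G)$ denotes the spectral radius (largest adjacency eigenvalue) of $G$. A fractional $r$-factor of $G$ exists if there is $h:E(G)\to[0,1]$ with $\sum_{e\ni v}h(e)=r$ for every vertex $v$. $K_m$ is the complete graph, $\cup$ disjoint union, $\vee$ join, $(r+1)K_1$ the edgeless graph on $r+1$ vertices. $F_n^{r}$ is the graph obtained from $K_{r}\vee\big(K_{n-2r-1}\cup(r+1)K_1\big)$ by adding $r-1$ edges between one (fixed) vertex of $(r+1)K_1$ and $r-1$ vertices of $K_{n-2r-1}$. *)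

(* Defs.v *)
From HB Require Import structures.
From mathcomp Require Import all_boot all_order all_algebra.
From mathcomp Require Import boolp classical_sets reals.

Set Implicit Arguments.
Unset Strict Implicit.
Unset Printing Implicit Defensive.

Import Order.TTheory GRing.Theory Num.Theory.

Record sgraph (T : finType) := SGraph {
  adj :> rel T;
  adj_sym : symmetric adj;
  adj_irr : irreflexive adj
}.

Section GraphNotions.
Variables (T : finType) (G : sgraph T).

Definition degree (v : T) : nat := #|[set w | G v w]|.

(* The default #|T| exceeds every degree, so it is never the value of the
   minimum when T is nonempty. *)
Definition min_degree : nat := \big[minn/#|T|]_(v : T) degree v.

Definition connected_graph : Prop :=
  (0 < #|T|)%N /\ forall x y : T, connect G x y.

Definition edges : {set {set T}} :=
  [set [set p.1; p.2] | p in [set p : T * T | G p.1 p.2]].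

Definition adj_mx (R : realType) : 'M[R]_#|T| :=
  (\matrix_(i, j) (G (enum_val i) (enum_val j))%:R)%R.

(* The adjacency matrix is real symmetric, so for a nonempty graph this set is
   finite and nonempty and its supremum is its largest element. *)
Definition spectral_radius (R : realType) : R :=
  sup [set a : R | eigenvalue (adj_mx R) a]%classic.

(* Only the values of h on the edges of G are constrained. *)
Definition has_fractional_factor (R : realType) (r : nat) : Prop :=
  exists h : {set T} -> R,
    (forall f, f \in edges -> (0 <= h f <= 1)%R) /\
    (forall v : T, (\sum_(f in edges | v \in f) h f)%R = (r%:R)%R).

End GraphNotions.

Definition isomorphic (T U : finType) (G : sgraph T) (H : sgraph U) : Prop :=
  exists2 phi : T -> U, bijective phi & forall x y, H (phi x) (phi y) = G x y.

Section Complete.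
Variable T : finType.

Fact complete_sym : symmetric (fun x y : T => x != y).
Proof. by move=> x y; rewrite eq_sym. Qed.
Fact complete_irr : irreflexive (fun x y : T => x != y).
Proof. by move=> x; rewrite eqxx. Qed.
Definition complete := SGraph complete_sym complete_irr.

Fact edgeless_sym : symmetric (fun _ _ : T => false).
Proof. by []. Qed.
Fact edgeless_irr : irreflexive (fun _ _ : T => false).
Proof. by []. Qed.
Definition edgeless := SGraph edgeless_sym edgeless_irr.

End Complete.

Section SumGraphs.
Variables (T U : finType) (G : sgraph T) (H : sgraph U).

(* cross tells whether the two sides are completely joined or not joined. *)
Definition sum_adj (cross : bool) : rel (T + U)%type := fun a b =>
  match a, b with
  | inl x, inl y => G x y
  | inr x, inr y => H x y
  | _, _ => cross
  end.

Fact sum_adj_sym cross : symmetric (sum_adj cross).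
Proof. by case=> x [] y //=; rewrite adj_sym. Qed.
Fact sum_adj_irr cross : irreflexive (sum_adj cross).
Proof. by case=> x /=; rewrite adj_irr. Qed.

Definition disjoint_union := SGraph (sum_adj_sym false) (sum_adj_irr false).
Definition join := SGraph (sum_adj_sym true) (sum_adj_irr true).

End SumGraphs.

Section AddEdges.
Variables (T : finType) (G : sgraph T) (v : T) (W : {set T}).

Definition add_star_adj : rel T := fun x y =>
  G x y || (x != y) && ((x == v) && (y \in W) || (y == v) && (x \in W)).

Fact add_star_sym : symmetric add_star_adj.
Proof. by move=> x y; rewrite /add_star_adj adj_sym eq_sym orbC [X in _ && X]orbC orbC. Qed.
Fact add_star_irr : irreflexive add_star_adj.
Proof. by move=> x; rewrite /add_star_adj adj_irr eqxx. Qed.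
Definition add_star := SGraph add_star_sym add_star_irr.

End AddEdges.

(* Vertices of K_r, of K_(n - 2r - 1) and of (r + 1)K_1, in this order; there
   are n of them as soon as 2r + 1 <= n. *)
Definition F_vertex (n r : nat) : finType :=
  ('I_r + ('I_(n - 2 * r - 1) + 'I_r.+1))%type.

(* The r - 1 added edges join vertex 0 of (r + 1)K_1 to the first r - 1
   vertices of K_(n - 2r - 1); by symmetry the choice is irrelevant. There are
   indeed r - 1 of them as soon as 1 <= r and 3r <= n. *)
Definition F_graph (n r : nat) : sgraph (F_vertex n r) :=
  add_star
    (join (complete 'I_r)
       (disjoint_union (complete 'I_(n - 2 * r - 1)) (edgeless 'I_r.+1)))
    (inr (inr ord0))
    [set inr (inl j) | j : 'I_(n - 2 * r - 1) & (j < r - 1)%N].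

(* Main.v *)
Require Import Defs.
From mathcomp Require Import boolp classical_sets topology normedtype derive.
From mathcomp Require Import all_boot all_order all_algebra.
From mathcomp Require Import reals.
From mathcomp Require Import ring lra zify.

Set Implicit Arguments.
Unset Strict Implicit.
Unset Printing Implicit Defensive.

Import Order.TTheory GRing.Theory Num.Theory.
Import numFieldNormedType.Exports.

(* Max-flow min-cut on the bipartite double cover shows that a graph without
   fractional r-factor has disjoint vertex sets S, U such that
   r |S| + sum_(u in U) d_(G - S)(u) < r |U|; the bound on the minimum degree
   then forces |U| > r.

   If |U| >= r + 2, then G has so few edges that Hong's bound
   (lambda + 1)(lambda - r) <= 2 m - n r contradicts
   lambda >= lambda(F) >= n - r - 2.

   If |U| = r + 1, put q = n - r - 1.  Testing F with the vector equal to 1 on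
   the clique of order q and to d(u) / lambda on the other vertices u gives
   lambda q (lambda - q + 1) >= (2 r - 1)^2 + r^3, the sum of the squares of
   the degrees of these vertices in F.  Up to lower-order terms, lambda(G) q
   (lambda(G) - q + 1) is at most the sum of d(u)^2 over u in U.  That sum is
   smaller by r - 1 if all the degrees in U are at most 2 r - 2, because their
   total is bounded and each of them is at least r.  If on the other hand some
   degree is at least 2 r - 1, then all the degree counts are tight and G is
   isomorphic to a spanning subgraph of F, so that the positive eigenvector of
   G leaves no room for a missing edge. *)

(** * Fractional factors and flows *)

Section Bipartite.
Variables (T : finType) (G : rel T).
Implicit Types (F : {set T * T}) (u v x y : T).

Definition row_deg F u := #|[set v | (u, v) \in F]|.
Definition col_deg F v := #|[set u | (u, v) \in F]|.

Lemma row_deg_setU1 F p x :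
  p \notin F -> row_deg (p |: F) x = row_deg F x + (x == p.1).
Proof.
case: p => a b /= pF; rewrite /row_deg.
have [->|xa] := eqVneq x a.
  rewrite (_ : finset _ = b |: [set v | (a, v) \in F]).
    by rewrite cardsU1 inE pF addnC.
  by apply/setP=> z; rewrite !inE xpair_eqE eqxx.
by rewrite addn0; congr #|pred_of_set _|; apply/setP=> z; rewrite !inE xpair_eqE (negbTE xa).
Qed.

Lemma col_deg_setU1 F p y :
  p \notin F -> col_deg (p |: F) y = col_deg F y + (y == p.2).
Proof.
case: p => a b /= pF; rewrite /col_deg.
have [->|yb] := eqVneq y b.
  rewrite (_ : finset _ = a |: [set u | (u, b) \in F]).
    by rewrite cardsU1 inE pF addnC.
  by apply/setP=> z; rewrite !inE xpair_eqE eqxx andbT.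
rewrite addn0; congr #|pred_of_set _|; apply/setP=> z.
by rewrite !inE xpair_eqE (negbTE yb) andbF.
Qed.

Lemma row_deg_sum F u : row_deg F u = \sum_v ((u, v) \in F).
Proof. by rewrite /row_deg -sum1dep_card big_mkcond; apply: eq_bigr => v _; case: (_ \in _). Qed.

Lemma col_deg_sum F v : col_deg F v = \sum_u ((u, v) \in F).
Proof. by rewrite /col_deg -sum1dep_card big_mkcond; apply: eq_bigr => u _; case: (_ \in _). Qed.

Lemma sum_row_deg F : \sum_u row_deg F u = #|F|.
Proof.
under eq_bigr do rewrite row_deg_sum.
rewrite pair_big /= -sum1_card [RHS]big_mkcond /=.
by apply: eq_bigr => -[a b] _ /=; case: (_ \in _).
Qed.

Lemma sum_col_deg F : \sum_v col_deg F v = #|F|.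
Proof.
rewrite -sum_row_deg; under eq_bigr do rewrite col_deg_sum.
by rewrite exchange_big; apply: eq_bigr => u _; rewrite row_deg_sum.
Qed.

(* F is a subgraph of the bipartite double cover of G: (u, v) in F is an edge
   from u in the left copy (inl) to v in the right copy (inr). *)
Definition residual F (a b : T + T) : bool :=
  match a, b with
  | inl u, inr v => G u v && ((u, v) \notin F)
  | inr v, inl u => (u, v) \in F
  | _, _ => false
  end.

Definition sub_rel_set F := forall u v, (u, v) \in F -> G u v.

(* Adding (u, v1) and removing (u2, v1) transfers the deficit from u to u2; the
   rest of the path does not meet v1 again, so it remains residual. *)
Lemma residual_path_augment m p F u v : size p <= m -> sub_rel_set F ->
  path (residual F) (inl u) p -> last (inl u) p = inr v -> uniq (inl u :: p) ->
  exists F', [/\ sub_rel_set F', forall x, row_deg F' x = row_deg F x + (x == u)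
               & forall y, col_deg F' y = col_deg F y + (y == v)].
Proof.
elim: m p F u => [|m IHm] [|[//|v1] p] F u //= pm FG /andP[/andP[Guv uvF]].
have UG : sub_rel_set ((u, v1) |: F).
  by move=> a b; rewrite in_setU1 => /orP[/eqP[-> ->]//|/FG].
case: p pm => [|[u2|//] p] /= pm.
  move=> _ [<-] _; exists ((u, v1) |: F).
  split=> // z; first exact: row_deg_setU1.
  exact: col_deg_setU1.
move=> /andP[u2F pth] lst /and3P[uN v1N /andP[u2N up]].
have uu2 : u2 != u by apply: contraNneq uN => ->; rewrite !inE eqxx orbT.
set F2 := ((u, v1) |: F) :\ (u2, v1).
have u2U : (u2, v1) \in (u, v1) |: F by rewrite in_setU1 u2F orbT.
have F2G : sub_rel_set F2 by move=> a b; rewrite in_setD1 => /andP[_ /UG].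
have pth2 : path (residual F2) (inl u2) p.
  have v1N' : inr v1 \notin (inl u2 :: p) by rewrite inE.
  have key a b : b != v1 -> ((a, b) \in F2) = ((a, b) \in F).
    by move=> bv; rewrite !inE !xpair_eqE (negbTE bv) !andbF.
  rewrite -(@eq_in_path _ (mem (inl u2 :: p)) (residual F)) //; last by apply/allP.
  move=> [a|a] [b|b] ha hb //=.
    by rewrite key //; apply: contraNneq v1N' => <-.
  by rewrite key //; apply: contraNneq v1N' => <-.
have sp : size p <= m by lia.
have up2 : uniq (inl u2 :: p) by rewrite /= u2N.
have [F' [F'G rF' cF']] := IHm p F2 u2 sp F2G pth2 lst up2.
have F2N : (u2, v1) \notin F2 by rewrite !inE eqxx.
(* Both [F] and [F2] become this set when one pair in column [v1] is added, so their column degrees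
   agree and their row degrees differ only by the shift from [u2] to [u]. *)
have UE : (u2, v1) |: F2 = (u, v1) |: F by rewrite setD1K.
exists F'; split=> // z.
  by rewrite rF' -(row_deg_setU1 z uvF) -UE row_deg_setU1.
have := col_deg_setU1 z F2N; rewrite UE col_deg_setU1 //= cF' => /addIn <- //.
Qed.

(** Take [F] of maximum size with all row and column degrees at most r. If some row [u0] is
    deficient, the vertices reachable from [u0] in the residual graph form the cut: columns in [B]
    are full by maximality, every pair of [F] ending in [B] starts in [A], and [F] contains all
    edges from [A] to the complement of [B]. *)
Lemma regular_subset_or_cut r :
  (exists F, [/\ sub_rel_set F, forall u, row_deg F u = r & forall v, col_deg F v = r])
  \/ exists A B : {set T},
       r * #|B| + \sum_(u in A) \sum_(w in ~: B) G u w < r * #|A|.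
Proof.
pose P F := [&& [forall p in F, G p.1 p.2], [forall u, row_deg F u <= r]
                & [forall v, col_deg F v <= r]].
have P0 : P set0.
  apply/and3P; split; apply/forallP => x; first by rewrite inE.
    by rewrite /row_deg (_ : finset _ = set0) ?cards0 //; apply/setP=> z; rewrite !inE.
  by rewrite /col_deg (_ : finset _ = set0) ?cards0 //; apply/setP=> z; rewrite !inE.
case: (arg_maxnP (fun F => #|F|) P0) => F /and3P[/forall_inP FG0 /forallP rF /forallP cF] maxF.
have FG : sub_rel_set F by move=> u v /FG0.
have [/forallP rr|] := boolP [forall u, row_deg F u == r].
  left; exists F; split=> // [u|]; first exact/eqP.
  (* Full rows fix the size of [F] at r times the number of vertices, which leaves no column a
     deficit. *)
  have : \sum_v (r - col_deg F v) = 0.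
    rewrite sumnB // sum_col_deg -sum_row_deg -sumnB //.
    by apply: big1 => u _; rewrite (eqP (rr u)) subnn.
  move/eqP; rewrite sum_nat_eq0 => /forallP cc v; have := cc v.
  by rewrite implyTb subn_eq0 => h; apply/eqP; rewrite eqn_leq h cF.
rewrite negb_forall => /existsP[u0 u0r]; right.
have {}u0r : row_deg F u0 < r by rewrite ltn_neqAle u0r rF.
pose A := [set u | connect (residual F) (inl u0) (inl u)].
pose B := [set v | connect (residual F) (inl u0) (inr v)].
have cB v : v \in B -> col_deg F v = r.
  rewrite inE => /connectP[p pth lst]; apply/eqP; rewrite eqn_leq cF leqNgt; apply/negP => cv.
  case: (shortenP pth) lst => p' pth' up' _ lst.
  have [F' [F'G rF' cF']] := residual_path_augment (leqnn _) FG pth' (esym lst) up'.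
  have : P F'.
    apply/and3P; split; first by apply/forall_inP => -[a b] /F'G.
      apply/forallP => x; rewrite rF'; have := rF x.
      by case: (eqVneq x u0) => [->|]; rewrite ?addn1 ?addn0.
    apply/forallP => x; rewrite cF'; have := cF x.
    by case: (eqVneq x v) => [->|]; rewrite ?addn1 ?addn0.
  move/maxF; rewrite -!sum_row_deg (eq_bigr _ (fun x _ => rF' x)) big_split /=.
  by rewrite [X in _ + X](bigD1 u0) //= eqxx; lia.
exists A, B.
have AB u v : u \in A -> v \notin B -> ((u, v) \in F) = G u v.
  rewrite !inE => uA vB; apply/idP/idP => [/FG//|Guv]; apply: contraNT vB => uvF.
  by apply: connect_trans uA (connect1 _); rewrite /= Guv.
have BA u v : v \in B -> (u, v) \in F -> u \in A.
  rewrite !inE => vB uvF; exact: connect_trans vB (connect1 _).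
have u0A : u0 \in A by rewrite inE connect0.
have : \sum_(u in A) row_deg F u < r * #|A|.
  rewrite mulnC -sum_nat_const [X in X < _](bigD1 u0) //= [X in _ < X](bigD1 u0) //=.
  by rewrite -addSn leq_add // leq_sum.
suff -> : \sum_(u in A) row_deg F u = r * #|B| + \sum_(u in A) \sum_(w in ~: B) G u w by [].
transitivity (\sum_(u in A) (\sum_(v in B) ((u, v) \in F) + \sum_(w in ~: B) G u w)).
  apply: eq_bigr => u uA; rewrite row_deg_sum (bigID (mem B)) /=; congr (_ + _).
  by apply: eq_big => [v|v /= vB]; rewrite ?inE ?AB.
rewrite big_split /=; congr (_ + _).
rewrite exchange_big mulnC -sum_nat_const; apply: eq_bigr => v vB.
rewrite -(cB v vB) col_deg_sum [RHS](bigID (mem A)) /= [X in _ = _ + X]big1 ?addn0 //.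
by move=> u; apply: contraNeq; rewrite eqb0 negbK; exact: BA.
Qed.

End Bipartite.

Section Factor.
Variables (T : finType) (G : sgraph T).

Lemma fractional_factor_of_subset (R : realType) r (F : {set T * T}) :
  sub_rel_set G F -> (forall u, row_deg F u = r) -> (forall v, col_deg F v = r) ->
  has_fractional_factor G R r.
Proof.
move=> FG rF cF.
(* h is the symmetrization ((u, v) \in F + (v, u) \in F) / 2. *)
pose h (e : {set T}) : R := ((#|[set p in F | [set p.1; p.2] == e]|)%:R / 2%:R)%R.
exists h; split.
  move=> _ /imsetP[[a b] _ ->] /=; apply/andP; split.
    by rewrite /h mulr_ge0 ?invr_ge0 ?ler0n.
  rewrite /h ler_pdivrMr ?ltr0n // mul1r ler_nat.
  (* Only the two orientations of an edge contribute, so half the count is at most 1. *)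
  apply: (@leq_trans #|[set (a, b); (b, a)]|); last by rewrite cards2; case: (_ != _).
  apply: subset_leq_card; apply/subsetP => -[c d]; rewrite !inE /= => /andP[cdF /eqP/setP E].
  have ncd : c != d by apply: contraTneq (FG _ _ cdF) => ->; rewrite adj_irr.
  have := E c; have := E d; rewrite !inE !eqxx ?orbT !xpair_eqE.
  move=> /esym/orP[]/eqP dE /esym/orP[]/eqP cE; move: ncd; rewrite dE cE ?eqxx ?orbT //.
move=> v; rewrite /h.
transitivity ((\sum_(e in edges G | v \in e) (#|[set p in F | [set p.1; p.2] == e]|)%:R) / 2 : R)%R.
  by rewrite mulr_suml.
(* The total at [v] counts the r pairs of [F] that start at [v] and the r pairs that end there. *)
suff -> : (\sum_(e in edges G | v \in e) (#|[set p in F | [set p.1; p.2] == e]|)%:R =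
   (r + r)%:R :> R)%R.
  by rewrite addnn -muln2 natrM mulfK // pnatr_eq0.
rewrite -natr_sum; congr (_%:R)%R.
transitivity (\sum_(e in edges G | v \in e) \sum_(p in F | [set p.1; p.2] == e) 1).
  by apply: eq_bigr => e _; rewrite sum1dep_card.
rewrite (exchange_big_dep (mem F)) //=; last by move=> ? ? ? /andP[].
transitivity (\sum_(p in F) ((p.1 == v) + (p.2 == v))).
  apply: eq_bigr => -[a b] abF /=.
  have Gab := FG _ _ abF.
  have ab : a != b by apply: contraTneq Gab => ->; rewrite adj_irr.
  have vE : (v \in [set a; b]) = (a == v) || (b == v) by rewrite !inE ![v == _]eq_sym.
  have abE : [set a; b] \in edges G by apply/imsetP; exists (a, b); rewrite ?inE.
  rewrite (_ : (a == v) + (b == v) = (v \in [set a; b])); last first.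
    by rewrite vE; case: (eqVneq a v) => [<-|//]; rewrite eq_sym (negbTE ab).
  case: (boolP (v \in [set a; b])) => vab.
    rewrite (big_pred1 [set a; b]) // => e.
    by rewrite abF /= [_ == e]eq_sym; case: (eqVneq e) => [->|_]; rewrite ?andbF // abE vab.
  rewrite big_pred0 // => e; rewrite [_ == e]eq_sym.
  by case: (eqVneq e) => [->|_]; rewrite ?(negbTE vab) ?andbF.
rewrite big_split /= -[X in _ = X + _](rF v) -[X in _ = _ + X](cF v) row_deg_sum col_deg_sum.
have sumF (f : T -> T -> nat) :
    \sum_(p in F) f p.1 p.2 = \sum_a \sum_b ((a, b) \in F) * f a b.
  rewrite pair_big [LHS]big_mkcond; apply: eq_bigr => -[a b] _ /=.
  by case: ifP; rewrite ?mul1n.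
congr (_ + _); [rewrite (sumF (fun a b => a == v : nat))|rewrite (sumF (fun a b => b == v : nat))].
  rewrite (bigD1 v) //= [X in _ + X]big1 ?addn0; first by apply: eq_bigr => b _; rewrite eqxx muln1.
  by move=> a /negbTE av; apply: big1 => b _; rewrite av muln0.
apply: eq_bigr => a _; rewrite (bigD1 v) //= [X in _ + X]big1 ?addn0; first by rewrite eqxx muln1.
by move=> b /negbTE bv; rewrite bv muln0.
Qed.

Lemma fractional_factor_or_deficient_pair (R : realType) r :
  has_fractional_factor G R r \/
  exists S U : {set T}, [disjoint S & U] /\
    r * #|S| + \sum_(u in U) \sum_(w in ~: S) G u w < r * #|U|.
Proof.
have [[F [FG rF cF]]|[A [B AB]]] := regular_subset_or_cut G r.
  by left; exact: fractional_factor_of_subset FG rF cF.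
(* Discarding A :&: B from both sides keeps the inequality, because the edges
   from A :&: B to A :\: B are counted once on each side. *)
right; exists (B :\: A), (A :\: B); split.
  by rewrite -setI_eq0; apply/eqP/setP => z; rewrite !inE; case: (z \in A); rewrite ?andbF.
pose e (X Y : {set T}) := \sum_(u in X) \sum_(w in Y) G u w.
have eUl (X Y Z : {set T}) : [disjoint X & Y] -> e (X :|: Y) Z = e X Z + e Y Z.
  move=> XY; rewrite /e -bigU //=; apply: eq_bigl => u.
  by rewrite !inE.
have eC (X Y : {set T}) : e X Y = e Y X.
  rewrite /e exchange_big; apply: eq_bigr => u _; apply: eq_bigr => w _.
  by rewrite adj_sym.
have eUr (X Y Z : {set T}) : [disjoint X & Y] -> e Z (X :|: Y) = e Z X + e Z Y.
  by move=> XY; rewrite eC eUl // !(eC Z).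
have dis (P Q : {set T}) : [disjoint P :&: Q & P :\: Q].
  by rewrite -setI_eq0; apply/eqP/setP => z; rewrite !inE; case: (z \in Q); rewrite ?andbF.
have disC : [disjoint ~: B & A :&: B].
  by rewrite -setI_eq0; apply/eqP/setP => z; rewrite !inE; case: (z \in B); rewrite ?andbF.
have CE : ~: (B :\: A) = ~: B :|: (A :&: B).
  by apply/setP => z; rewrite !inE; case: (z \in A); case: (z \in B).
have sub : e (A :&: B) (A :\: B) <= e (A :&: B) (~: B).
  apply: leq_sum => u _; rewrite [leqRHS](big_setID (A :\: B)) /= (setIidPr _) ?leq_addr //.
  by apply/subsetP => w; rewrite !inE => /andP[].
move: AB; rewrite -/(e A (~: B)) -/(e (A :\: B) _) CE.
rewrite -[in e A _](setID A B) eUl // -(cardsID A B) -(cardsID B A) (setIC B A).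
rewrite eUr // [e (_ :\: _) (_ :&: _)]eC.
move: sub; set x := e _ _; set y := e _ _; set z := e _ _.
by rewrite !mulnDr; lia.
Qed.

End Factor.

(** * The spectral radius *)

Section Spectral.
Local Open Scope ring_scope.
Variables (R : realType) (n : nat).
Implicit Types (A : 'M[R]_n) (x y z : 'rV[R]_n).

Definition dot x y : R := \sum_i x 0 i * y 0 i.
Definition qform A x : R := \sum_i \sum_j A i j * x 0 i * x 0 j.

Lemma qformE A x : qform A x = dot (x *m A) x.
Proof.
rewrite /qform /dot exchange_big; apply: eq_bigr => j _; rewrite mxE mulr_suml.
by apply: eq_bigr => i _; rewrite [A i j * _]mulrC.
Qed.

Lemma dotC x y : dot x y = dot y x.
Proof. by apply: eq_bigr => i _; rewrite mulrC. Qed.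

Lemma dotDl x y z : dot (x + y) z = dot x z + dot y z.
Proof. by rewrite /dot -big_split; apply: eq_bigr => i _; rewrite mxE mulrDl. Qed.

Lemma dotZl c x z : dot (c *: x) z = c * dot x z.
Proof. by rewrite /dot mulr_sumr; apply: eq_bigr => i _; rewrite mxE mulrA. Qed.

Lemma dot_ge0 x : 0 <= dot x x.
Proof. by apply: sumr_ge0 => i _; exact: sqr_ge0. Qed.

Lemma dot_eq0 x : (dot x x == 0) = (x == 0).
Proof.
apply/eqP/eqP => [/eqP|->]; last by rewrite /dot big1 // => i _; rewrite mxE mul0r.
rewrite psumr_eq0 => [/allP h|i _]; last exact: sqr_ge0.
apply/rowP => i; rewrite mxE; apply/eqP.
by have := h i (mem_index_enum _); rewrite /= mulf_eq0 orbb.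
Qed.

Lemma continuous_sumr (I : finType) (f : I -> 'rV[R]_n -> R) :
  (forall i, continuous (f i)) -> continuous (fun x => \sum_i f i x).
Proof.
move=> cf x; elim: (index_enum I) => [|i s IHs].
  suff -> : (fun y => \sum_(i <- [::]) f i y) = (fun=> 0) by exact: cst_continuous.
  by rewrite funeqE => y; rewrite big_nil.
have -> : (fun y => \sum_(j <- i :: s) f j y) = (fun y => f i y + \sum_(j <- s) f j y).
  by rewrite funeqE => y; rewrite big_cons.
by apply: continuousD; [exact: cf|exact: IHs].
Qed.

Lemma qform_continuous A : continuous (qform A).
Proof.
apply: continuous_sumr => i; apply: continuous_sumr => j x.
apply: (@continuousM R _ (fun y : 'rV[R]_n => A i j * y 0 i) (fun y : 'rV[R]_n => y 0 j));
  last exact: coord_continuous.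
by apply: continuousM; [exact: cst_continuous|exact: coord_continuous].
Qed.

Lemma dot_qform1 x : dot x x = qform 1%:M x.
Proof. by rewrite qformE mulmx1. Qed.

Lemma qformZ A c x : qform A (c *: x) = c ^+ 2 * qform A x.
Proof. by rewrite !qformE -scalemxAl dotZl dotC dotZl dotC mulrA expr2. Qed.

Lemma dot_symm A x y : A^T = A -> dot (x *m A) y = dot (y *m A) x.
Proof.
move=> sA; rewrite /dot.
under eq_bigr do rewrite mxE mulr_suml.
under [RHS]eq_bigr do rewrite mxE mulr_suml.
rewrite exchange_big; apply: eq_bigr => i _; apply: eq_bigr => j _.
by rewrite -[in LHS]sA mxE; ring.
Qed.

Lemma qform_sphere_max A : (0 < n)%N ->
  exists2 x, dot x x = 1 & forall y, dot y y = 1 -> qform A y <= qform A x.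
Proof.
move=> n0.
pose K : set 'rV[R]_n := [set y | dot y y = 1]%classic.
have K0 : (K !=set0)%classic.
  pose o := Ordinal n0; exists (delta_mx 0 o : 'rV[R]_n).
  have dE k : (delta_mx 0 o : 'rV[R]_n) 0 k = (k == o)%:R by rewrite mxE eqxx.
  rewrite /K /= /dot (bigD1 o) //= !dE eqxx mulr1.
  by rewrite big1 ?addr0 // => i /negbTE i0; rewrite !dE i0 mul0r.
have Kc : compact K.
  apply: bounded_closed_compact.
    exists 1; split; first exact: num_real.
    move=> M M1 y Ky /=; apply: le_trans (ltW M1).
    (* The norm of a row vector is its largest absolute entry, and each squared entry is at most
       [dot y y]. *)
    rewrite /Num.norm /= mx_normrE; apply: bigmax_le => // -[i j] _ /=.
    rewrite (ord1 i) -(@ler_pXn2r _ 2) ?nnegrE ?expr1n ?normr_ge0 //.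
    rewrite -[1](Ky : dot y y = 1) -normrX ger0_norm ?sqr_ge0 // /dot (bigD1 j) //=.
    by rewrite expr2 lerDl; apply: sumr_ge0 => k _; exact: sqr_ge0.
  rewrite (_ : K = (qform 1%:M @^-1` [set 1])%classic); last first.
    by apply/seteqP; split => y; rewrite /K /= dot_qform1.
  by apply: preimage_closed => [x _|]; [exact: qform_continuous|exact: closed_eq].
have [x xK xmax] := @EVT_max_rV R n (qform A) K K0 Kc (continuous_subspaceT (@qform_continuous A)).
exists x; first exact: set_mem xK.
by move=> y yK; apply: xmax; exact: mem_set.
Qed.

Lemma qform_le A m : (forall y, dot y y = 1 -> qform A y <= m) ->
  forall y, qform A y <= m * dot y y.
Proof.
move=> h y; have [->|y0] := eqVneq y 0.
  by rewrite qformE mul0mx (eqP (_ : dot 0 0 == 0)) ?dot_eq0 // mulr0.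
have d0 : 0 < dot y y by rewrite lt_def dot_ge0 dot_eq0 y0.
have sK : (Num.sqrt (dot y y))^-1 ^+ 2 = (dot y y)^-1 by rewrite exprVn sqr_sqrtr ?dot_ge0.
have := h ((Num.sqrt (dot y y))^-1 *: y).
rewrite dot_qform1 !qformZ -dot_qform1 sK mulVf ?gt_eqF // => /(_ erefl).
by rewrite ler_pdivrMl // mulrC.
Qed.

(** Moving from [x] in the direction [z = x *m A] changes the form by a quadratic in t with linear
    term [2 * t * dot z z]; a small negative t would make the form negative unless [z] vanishes. *)
Lemma psd_null A x : A^T = A -> (forall y, 0 <= qform A y) -> qform A x = 0 ->
  x *m A = 0.
Proof.
move=> sA psd xA0; apply/eqP; rewrite -dot_eq0; apply/eqP.
set z := x *m A; set c := qform A z.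
have c0 : 0 <= c := psd z.
have quad t : qform A (x + t *: z) = 2 * t * dot z z + t ^+ 2 * c.
  rewrite qformE mulmxDl dotDl ![dot _ (x + _)]dotC !dotDl ![dot _ (_ *m A)]dotC -!qformE.
  rewrite xA0 qformZ -/c dotC dotZl -/z -scalemxAl dotZl (dot_symm _ _ sA) -/z; ring.
(* The summand 1 in [c + 1] keeps the denominator positive when [c] is 0. *)
have := psd (x + - (dot z z / (c + 1)) *: z); rewrite quad.
have -> : 2 * - (dot z z / (c + 1)) * dot z z + (- (dot z z / (c + 1))) ^+ 2 * c =
  - ((c + 2) / (c + 1) ^+ 2 * dot z z ^+ 2).
  by field; rewrite gt_eqF //; lra.
rewrite oppr_ge0 pmulr_rle0; last by rewrite divr_gt0 ?exprn_gt0 //; lra.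
by move=> h; apply/eqP; rewrite -sqrf_eq0 eq_le h sqr_ge0.
Qed.

(** Replacing the entries of a maximizer on the unit sphere by their absolute values does not lower
    the form, as [A] is nonnegative. The matrix [m%:M - A] is then positive semidefinite with form 0
    at this vector, hence kills it. *)
Lemma symmetric_top_eigenvector A : (0 < n)%N -> A^T = A ->
  (forall i j, 0 <= A i j) ->
  exists m x, [/\ x != 0, forall i, 0 <= x 0 i, x *m A = m *: x
                & forall y, qform A y <= m * dot y y].
Proof.
move=> n0 sA A0; have [x0 x0n xmax] := qform_sphere_max A n0.
pose x : 'rV[R]_n := \row_i `|x0 0 i|.
have xn : dot x x = 1.
  by rewrite -x0n; apply: eq_bigr => i _; rewrite mxE -normrM ger0_norm ?sqr_ge0.
have Ax : qform A x = qform A x0.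
  apply/eqP; rewrite eq_le xmax //=.
  apply: ler_sum => i _; apply: ler_sum => j _.
  by rewrite !mxE -!mulrA ler_wpM2l // -normrM ler_norm.
have xle := qform_le xmax.
set m := qform A x0 in xmax Ax xle *.
exists m, x; split=> //.
- by rewrite -dot_eq0 xn oner_eq0.
- by move=> i; rewrite mxE normr_ge0.
pose B := m%:M - A.
have qB y : qform B y = m * dot y y - qform A y.
  rewrite !qformE mulmxBr mul_mx_scalar /dot mulr_sumr -sumrB.
  by apply: eq_bigr => i _; rewrite !mxE; ring.
have : x *m B = 0.
  apply: psd_null; first by rewrite linearB /= tr_scalar_mx sA.
    by move=> y; rewrite qB subr_ge0.
  by rewrite qB xn Ax mulr1 subrr.
by move/eqP; rewrite mulmxBr mul_mx_scalar subr_eq0 => /eqP.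
Qed.

End Spectral.

Lemma sup_max (R : realType) (A : set R) (a : R) : A a -> ubound A a -> sup A = a.
Proof.
move=> Aa ubA; apply/eqP; rewrite eq_le; apply/andP; split.
  by apply: ge_sup => //; exists a.
by apply: ub_le_sup => //; exists a.
Qed.

Section GraphSpectral.
Local Open Scope ring_scope.
Variables (R : realType) (T : finType) (G : sgraph T).

Local Notation lam := (spectral_radius G R).

Definition graph_form (y : T -> R) : R := \sum_u \sum_v (G u v)%:R * y u * y v.

(** This identifies the supremum of the eigenvalues with the maximal Rayleigh quotient. All later
    bounds rest on these two facts, the nonnegative eigenvector and the variational inequality. *)
Lemma spectral_radiusP : (0 < #|T|)%N ->
  [/\ (exists x : T -> R, [/\ exists v, x v != 0, forall v, 0 <= x v
       & forall v, \sum_u (G v u)%:R * x u = lam * x v]) &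
   forall y : T -> R, graph_form y <= lam * \sum_v y v ^+ 2].
Proof.
move=> T0; set A := adj_mx G R.
have sA : A^T = A by apply/matrixP => i j; rewrite !mxE adj_sym.
have A0 i j : 0 <= A i j by rewrite mxE.
have [m [x [x0 xp xA mmax]]] := symmetric_top_eigenvector T0 sA A0.
have -> : lam = m.
  apply: sup_max; first by apply/eigenvalueP; exists x.
  move=> a /eigenvalueP[y yA y0]; have := mmax y.
  by rewrite qformE yA dotZl ler_pM2r // lt_def dot_ge0 dot_eq0 y0.
split.
  exists (fun v => x 0 (enum_rank v)); split=> // [|v].
    move: x0; rewrite -dot_eq0; apply: contra_neqP => /forallNP h.
    rewrite /dot big1 // => i _; have := h (enum_val i).
    by rewrite enum_valK => /negP; rewrite negbK => /eqP ->; rewrite mul0r.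
  move/rowP: xA => /(_ (enum_rank v)); rewrite !mxE => <-.
  rewrite [RHS](reindex _ (onW_bij _ (@enum_rank_bij T))) /=.
  by apply: eq_bigr => u _; rewrite !mxE !enum_rankK mulrC adj_sym.
move=> y; have := mmax (\row_i y (enum_val i)).
rewrite /qform /dot.
rewrite (reindex _ (onW_bij _ (@enum_rank_bij T))) [X in _ <= _ * X](reindex _ (onW_bij _ (@enum_rank_bij T))) /=.
rewrite (eq_bigr (fun u => \sum_v (G u v)%:R * y u * y v)); last first.
  move=> u _; rewrite (reindex _ (onW_bij _ (@enum_rank_bij T))) /=.
  by apply: eq_bigr => v _; rewrite !mxE !enum_rankK.
by under [X in _ <= _ * X -> _]eq_bigr do rewrite mxE enum_rankK -expr2.
Qed.

End GraphSpectral.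

(** * Degrees and eigenvalue bounds *)

Section Degrees.
Local Open Scope ring_scope.
Variables (T : finType) (G : sgraph T).

Lemma degree_sum v : degree G v = (\sum_w G v w)%N.
Proof.
by rewrite /degree -sum1dep_card big_mkcond; apply: eq_bigr => w _; case: (G v w).
Qed.

Lemma natr_degree (R : realType) v : (degree G v)%:R = \sum_w (G v w)%:R :> R.
Proof. by rewrite degree_sum natr_sum. Qed.

Lemma min_degree_le v : (min_degree G <= degree G v)%N.
Proof.
rewrite /min_degree; have := mem_index_enum v.
elim: (index_enum T) => // u s IHs; rewrite inE big_cons geq_min => /orP[/eqP->|/IHs ->].
  by rewrite leqnn.
by rewrite orbT.
Qed.

Lemma sum_neighbours_le (Q : {set T}) v : v \in Q -> (\sum_(w in Q) G v w <= #|Q|.-1)%N.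
Proof.
move=> vQ; rewrite (bigD1 v) //= adj_irr add0n (cardsD1 v Q) vQ add1n /=.
rewrite -sum1_card [leqRHS](eq_bigl (fun w => (w \in Q) && (w != v))); last first.
  by move=> w; rewrite !inE andbC.
by apply: leq_sum => w _; exact: leq_b1.
Qed.

(** The edges between [U] and its complement are counted by the degrees in [U], once from each end;
    all others outside [U] lie within the complement. *)
Lemma sum_degree_le (U : {set T}) :
  (\sum_v degree G v <= #|~: U| * #|~: U|.-1 + 2 * \sum_(u in U) degree G u)%N.
Proof.
rewrite (bigID (mem U)) /=.
suff : (\sum_(v | v \notin U) degree G v <=
        #|~: U| * #|~: U|.-1 + \sum_(u in U) degree G u)%N by lia.
under eq_bigr do rewrite degree_sum (bigID (mem U)) /= addnC.
rewrite big_split /=; apply: leq_add.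
  rewrite -sum_nat_const [leqRHS](eq_bigl (fun v => v \notin U)); last by move=> v; rewrite inE.
  apply: leq_sum => v vU; apply: leq_trans (@sum_neighbours_le (~: U) v _); last by rewrite inE.
  by rewrite [leqRHS](eq_bigl (fun w => w \notin U)) // => w; rewrite inE.
rewrite exchange_big /=; apply: leq_sum => u _; rewrite degree_sum big_mkcond.
by apply: leq_sum => v _; rewrite adj_sym; case: ifP.
Qed.

End Degrees.

Section Bounds.
Local Open Scope ring_scope.
Variables (R : realType) (T : finType) (G : sgraph T).
Local Notation lam := (spectral_radius G R).
Local Notation d v := ((degree G v)%:R : R).

(* The row sums of A^2 - (r - 1) A are at most 2 m - (n - 1) r. *)
Lemma spectral_radius_hong r : (0 < #|T|)%N -> (forall v, r <= degree G v)%N ->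
  (lam + 1) * (lam - r%:R) <= (\sum_v degree G v)%:R - (#|T| * r)%:R.
Proof.
move=> T0 dr; have [[x [[v0 xv0] x0 xlam]] _] := spectral_radiusP R G T0.
set X := \sum_v x v.
have X0 : 0 < X.
  rewrite /X (bigD1 v0) //= ltr_wpDr ?sumr_ge0 // lt_def xv0 x0 //.
(* Symmetry of the adjacency matrix lets it act on the eigenvector instead of on [f]. *)
have dx f : \sum_v (\sum_w (G v w)%:R * f w) * x v = lam * \sum_v f v * x v :> R.
  rewrite mulr_sumr; under eq_bigr do rewrite mulr_suml.
  rewrite exchange_big; apply: eq_bigr => w _; rewrite [RHS]mulrCA -xlam mulr_sumr.
  by apply: eq_bigr => v _; rewrite adj_sym; ring.
have dX : \sum_v d v * x v = lam * X.
  have := dx (fun=> 1); under [X in _ = lam * X -> _]eq_bigr do rewrite mul1r.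
  move=> <-; apply: eq_bigr => v _; rewrite natr_degree; congr (_ * _).
  by apply: eq_bigr => w _; rewrite mulr1.
(* The vertices not adjacent to [v], with [v] among them, each have degree at least r, so the sum of
   [d w - r] over them is at least [d v - r]. *)
have dd v : \sum_w (G v w)%:R * d w <= \sum_w d w - (#|T| * r)%:R + (r%:R - 1) * d v + r%:R.
  suff : d v - r%:R <= \sum_w (d w - r%:R) * (1 - (G v w)%:R).
    under [X in _ <= X -> _]eq_bigr => w _ do rewrite mulrBr mulr1 mulrBl [d w * _]mulrC.
    rewrite !sumrB -mulr_sumr -natr_degree sumr_const natrM mulr_natl; lra.
  rewrite (bigD1 v) //= adj_irr subr0 mulr1 lerDl; apply: sumr_ge0 => w _.
  by rewrite mulr_ge0 ?subr_ge0 ?ler_nat // lern1; case: (G v w).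
have : \sum_v (\sum_w (G v w)%:R * d w) * x v <=
       \sum_v (\sum_w d w - (#|T| * r)%:R + (r%:R - 1) * d v + r%:R) * x v.
  by apply: ler_sum => v _; apply: ler_wpM2r.
rewrite dx dX.
under [X in _ <= X -> _]eq_bigr => v _ do rewrite mulrDl mulrDl -mulrA addrAC -mulrDl.
rewrite big_split /= -!mulr_sumr -/X dX natr_sum -subr_ge0.
set m := \sum_w _.
have -> : (m - (#|T| * r)%:R + r%:R) * X + (r%:R - 1) * (lam * X) - lam * (lam * X)
   = X * (m - (#|T| * r)%:R - (lam + 1) * (lam - r%:R)) by ring.
by rewrite pmulr_rge0 // subr_ge0.
Qed.

(** The Rayleigh quotient is tested on the vector equal to 1 on the clique and to [c] times the
    degree on the independent set [U]; the choice of [c] is left to the application. *)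
Lemma clique_test_vector (U : {set T}) (c : R) : (0 < #|T|)%N ->
  {in U &, forall u v, ~~ G u v} -> {in ~: U &, forall u v, G u v = (u != v)} ->
  #|~: U|%:R * (#|~: U|%:R - 1) + 2 * c * (\sum_(u in U) d u ^+ 2) <=
    lam * (#|~: U|%:R + c ^+ 2 * \sum_(u in U) d u ^+ 2).
Proof.
move=> T0 Uind Qcl; set q := #|~: U|%:R; set D2 := \sum_(u in U) _.
pose y v := if v \in U then c * d v else 1.
have [_ /(_ y)] := spectral_radiusP R G T0.
have -> : \sum_v y v ^+ 2 = q + c ^+ 2 * D2.
  rewrite (bigID (mem U)) /= addrC; congr (_ + _).
    rewrite /q -sum1_card natr_sum; apply: eq_big => v; rewrite ?inE // /y => /negbTE ->.
    by rewrite expr1n.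
  by rewrite mulr_sumr; apply: eq_bigr => v vU; rewrite /y vU exprMn.
suff -> : graph_form G y = q * (q - 1) + 2 * c * D2 by [].
have rowU u : u \in U -> \sum_v (G u v)%:R * y u * y v = c * d u ^+ 2.
  move=> uU; transitivity (c * d u * \sum_v (G u v)%:R); last first.
    by rewrite -natr_degree expr2 mulrA.
  rewrite mulr_sumr; apply: eq_bigr => v _.
  rewrite /y uU; case: ifP => [vU|_]; last by ring.
  by rewrite (negbTE (Uind u v uU vU)) !mul0r mulr0.
have rowQ u : u \notin U -> \sum_v (G u v)%:R * y u * y v =
    q - 1 + \sum_(v in U) (G u v)%:R * (c * d v).
  move=> uU; rewrite (bigID (mem U)) /= addrC; congr (_ + _); last first.
    by apply: eq_bigr => v vU; rewrite /y vU (negbTE uU) mulr1.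
  have -> : q - 1 = \sum_(v in ~: U :\ u) 1.
    by rewrite sumr_const /q (cardsD1 u (~: U)) inE uU natrD addrC addKr.
  rewrite (bigD1 u) //= adj_irr !mul0r add0r; apply: eq_big => v; first by rewrite !inE andbC.
  by move=> /andP[vU vu]; rewrite /y (negbTE uU) (negbTE vU) Qcl ?inE // eq_sym vu !mulr1.
rewrite /graph_form (bigID (mem U)) /= (eq_bigr _ rowU) -mulr_sumr -/D2.
rewrite (eq_bigr _ rowQ) big_split /= exchange_big /=.
have -> : \sum_(i | i \notin U) (q - 1) = q * (q - 1).
  rewrite sumr_const -mulr_natl; congr (_ %:R * _).
  by apply: eq_card => v; rewrite !inE.
have -> : \sum_(v in U) \sum_(u | u \notin U) (G u v)%:R * (c * d v) = c * D2.
  rewrite mulr_sumr; apply: eq_bigr => v vU; rewrite -mulr_suml.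
  suff -> : \sum_(u | u \notin U) (G u v)%:R = d v by ring.
  rewrite natr_degree [RHS](bigID (mem U)) /= [X in _ = X + _]big1 ?add0r => [|u uU].
    by apply: eq_bigr => u _; rewrite adj_sym.
  by rewrite (negbTE (Uind _ _ vU uU)).
ring.
Qed.

(* An eigenvector entry on U is at most d(u) / lambda times the largest entry
   on the complement of U, which is about the average entry there. *)
Lemma spectral_radius_sparse_set (U : {set T}) k :
  (0 < #|~: U|)%N -> (forall u, u \in U -> degree G u <= k)%N -> k%:R < lam ->
  #|~: U|%:R - 1 <= lam ->
  (lam - #|~: U|%:R + 1) * (lam * (lam + 1) - \sum_(u in U) d u) <= \sum_(u in U) d u ^+ 2.
Proof.
move=> /card_gt0P[v1 v1Q] dk klam; set q := #|~: U|%:R => qlam.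
have T0 : (0 < #|T|)%N by apply/card_gt0P; exists v1.
have lam0 : 0 < lam by apply: le_lt_trans klam.
have [[x [[v0 xv0] x0 xlam]] _] := spectral_radiusP R G T0.
have [m mQ mmax] := @arg_maxP _ _ _ v1 (fun v => v \in ~: U) x v1Q.
have [t _ tmax] := @arg_maxP _ _ _ v1 predT x isT.
have {}tmax v : x v <= x t by exact: tmax.
have deg_le v a : (forall u, x u <= a) -> lam * x v <= d v * a.
  move=> xa; rewrite -xlam natr_degree mulr_suml; apply: ler_sum => u _.
  by rewrite ler_wpM2l.
(* A positive global maximum cannot sit in [U], where the degrees lie below [lam]. *)
have xM v : x v <= x m.
  apply: le_trans (tmax v) _; have [tU|tQ] := boolP (t \in U); last first.
    by apply: mmax; rewrite inE.
  have := deg_le t _ tmax; rewrite -subr_le0 -mulrBl pmulr_rle0.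
    by move=> h; exact: le_trans h (x0 m).
  by rewrite subr_gt0; apply: le_lt_trans klam; rewrite ler_nat dk.
have M0 : 0 < x m by apply: lt_le_trans (xM v0); rewrite lt_def xv0 x0.
pose X := \sum_(v in ~: U) x v; pose Y := \sum_(u in U) x u.
have XY : \sum_v x v = X + Y.
  by rewrite (bigID (mem U)) addrC /=; congr (_ + _); apply: eq_bigl => v; rewrite inE.
have hY : lam * Y <= (\sum_(u in U) d u) * x m.
  by rewrite mulr_sumr mulr_suml; apply: ler_sum => u _; exact: deg_le.
have hM : (lam + 1) * x m <= X + Y.
  rewrite mulrDl mul1r -XY -xlam [leRHS](bigD1 m) //= [leLHS]addrC lerD2l.
  rewrite (bigD1 m) //= adj_irr mul0r add0r; apply: ler_sum => u _.
  by rewrite -[leRHS]mul1r ler_wpM2r // lern1; case: (G m u).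
(* The eigenvector equation is summed over the complement of [U]: an entry there is counted at most
   [q - 1] times, an entry on [U] at most as often as its degree. *)
have hX : lam * X <= (q - 1) * X + \sum_(u in U) d u * x u.
  rewrite {1}/X mulr_sumr.
  under eq_bigr do rewrite -xlam (bigID (mem (~: U))) /=.
  rewrite big_split /=; apply: lerD.
    rewrite exchange_big /= mulr_sumr; apply: ler_sum => u uQ; rewrite -mulr_suml ler_wpM2r //.
    rewrite -natr_sum /q -(prednK (_ : 0 < #|~: U|)%N); last by apply/card_gt0P; exists v1.
    rewrite -natr1 addrK ler_nat; apply: leq_trans (sum_neighbours_le G uQ).
    by apply: leq_sum => v _; rewrite adj_sym.
  rewrite exchange_big /= (eq_bigl (mem U)); last by move=> u; rewrite !inE negbK.
  apply: ler_sum => u _; rewrite -mulr_suml ler_wpM2r // natr_degree.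
  rewrite [leRHS](bigID (mem (~: U))) /= (eq_bigr (fun v => (G u v)%:R)) ?lerDl ?sumr_ge0 //.
  by move=> v _; rewrite adj_sym.
have hX2 : lam * ((lam - q + 1) * X) <= x m * \sum_(u in U) d u ^+ 2.
  apply: (@le_trans _ _ (lam * \sum_(u in U) d u * x u)).
    by rewrite ler_pM2l //; lra.
  rewrite !mulr_sumr; apply: ler_sum => u _.
  by rewrite expr2 [leLHS]mulrCA [leRHS]mulrCA ler_wpM2l // [leRHS]mulrC; exact: deg_le.
rewrite -(ler_pM2l M0) (le_trans _ hX2) // mulrCA [leRHS]mulrCA ler_wpM2l //; first by lra.
have := ler_wpM2l (ltW lam0) hM; rewrite mulrDr mulrA; move: hY.
set D := \sum_(u in U) _; set L := lam * (lam + 1) => hY hM'.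
rewrite mulrBr [x m * D]mulrC [x m * L]mulrC; lra.
Qed.

End Bounds.

(** * The extremal graph *)

Section ExtremalGraph.
Variables (n r : nat).
Local Notation F := (F_graph n r).

Definition F_indep : {set F_vertex n r} :=
  [set v | if v is inr (inr _) then true else false].

Lemma F_adj_indep (k : 'I_r.+1) (v : F_vertex n r) :
  F (inr (inr k)) v =
  match v with
  | inl _ => true
  | inr (inl j) => (k == ord0) && (j < r - 1)
  | inr (inr _) => false
  end.
Proof.
pose W : {set F_vertex n r} := [set inr (inl j) | j : 'I_(n - 2 * r - 1) & j < r - 1].
have indepN k0 : (inr (inr k0) \in W) = false by apply/negP => /imsetP[].
case: v => [i|[j|k']]; rewrite /= /add_star_adj -/W //=; last by rewrite !indepN !andbF.
by rewrite orbF mem_imset ?inE // => ? ? [].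
Qed.

Lemma F_indep_stable : {in F_indep &, forall u v, ~~ F u v}.
Proof. by move=> [i|[j|k]] [i'|[j'|k']]; rewrite !inE // F_adj_indep. Qed.

Lemma F_clique : {in ~: F_indep &, forall u v, F u v = (u != v)}.
Proof.
move=> [i|[j|k]] [i'|[j'|k']]; rewrite !inE //= => _ _; rewrite /add_star_adj /= ?orbT //.
  by rewrite !andbF orbF.
by rewrite !andbF orbF.
Qed.

Hypotheses (r_gt0 : 0 < r) (rn : 3 * r <= n).

Lemma card_F_indepC : #|~: F_indep| = n - r - 1.
Proof.
rewrite -sum1_card big_mkcond /= big_sumType /= big_sumType /=.
rewrite (eq_bigr (fun=> 1)) => [|i _]; last by rewrite !inE.
rewrite [X in _ + (X + _)](eq_bigr (fun=> 1)) => [|i _]; last by rewrite !inE.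
rewrite [X in _ + (_ + X)]big1 => [|i _]; last by rewrite !inE.
by rewrite !sum_nat_const !card_ord; lia.
Qed.

Lemma F_degree_indep (k : 'I_r.+1) :
  degree F (inr (inr k)) = r + (k == ord0) * (r - 1).
Proof.
rewrite degree_sum; under eq_bigr do rewrite F_adj_indep.
rewrite big_sumType /= big_sumType /=.
rewrite sum_nat_const card_ord big1_eq addn0 muln1; congr (_ + _).
case: (k == ord0); last by rewrite big1_eq.
under eq_bigr do rewrite andTb.
rewrite mul1n -[RHS]card_ord -sum1_card.
rewrite -(big_mkord xpredT (fun j => (j < r - 1) : nat)) -(big_mkord xpredT (fun=> 1)).
rewrite (@big_cat_nat _ _ _ (r - 1)) //=; last by lia.
rewrite [X in _ + X]big_nat_cond [X in _ + X]big1 => [|i]; last by lia.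
by rewrite addn0 !big_mkord; apply: eq_bigr => i _; rewrite ltn_ord.
Qed.

Lemma sum_F_degree_indep_sq :
  \sum_(u in F_indep) degree F u ^ 2 = (2 * r - 1) ^ 2 + r * r ^ 2.
Proof.
rewrite big_mkcond /= big_sumType /= big_sumType /=.
rewrite big1 => [|i _]; last by rewrite !inE.
rewrite big1 => [|i _]; last by rewrite !inE.
rewrite (eq_bigr (fun k : 'I_r.+1 => (r + (k == ord0) * (r - 1)) ^ 2)) => [|k _]; last first.
  by rewrite !inE F_degree_indep.
rewrite (bigD1 ord0) //= mul1n !add0n (eq_bigr (fun=> r ^ 2)) => [|k /negbTE ->]; last first.
  by rewrite mul0n addn0.
rewrite sum_nat_const cardC1 card_ord /=; congr (_ ^ _ + _); lia.
Qed.

Local Open Scope ring_scope.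

(** The parameter [l] lets the bounds apply to the spectral radius of G directly. The test vector
    with [c] equal to 0 gives the first bound, and [c] equal to [l^-1] gives the second. *)
Lemma spectral_radius_F_ge (R : realType) (l : R) : spectral_radius F R <= l ->
  let q : R := (n - r - 1)%:R in
  q - 1 <= l /\ ((2 * r - 1) ^ 2 + r * r ^ 2)%:R <= l * q * (l - q + 1).
Proof.
move=> Fl q; set B : R := _%:R.
have q0 : 0 <= q by rewrite ler0n.
have B0 : 0 <= B by rewrite ler0n.
have T0 : (0 < #|F_vertex n r|)%N by apply/card_gt0P; exists (inr (inr ord0)).
have test c : q * (q - 1) + 2 * c * B <= l * (q + c ^+ 2 * B).
  have := clique_test_vector c T0 F_indep_stable F_clique.
  rewrite card_F_indepC -/q.
  under eq_bigr do rewrite -natrX.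
  rewrite -natr_sum sum_F_degree_indep_sq -/B => h; apply: (le_trans h).
  by apply: ler_wpM2r => //; rewrite addr_ge0 // mulr_ge0 // sqr_ge0.
have q1 : 1 <= q by rewrite ler1n; lia.
have B1 : 0 < B by rewrite ltr0n ltn_addl // muln_gt0 r_gt0 expn_gt0 r_gt0.
clearbody q B.
have ql : q - 1 <= l.
  have := test 0; rewrite expr0n /= mulr0 !mul0r !addr0 [l * q]mulrC ler_pM2l //; lra.
split=> //.
(* If [l] were 0, then [q] would be 1, and the test vector with [c] equal to 1 would give
   [2 * B <= 0]. *)
have l0 : 0 < l.
  rewrite lt_def (le_trans _ ql) ?subr_ge0 // andbT; apply/eqP => l0.
  have := test 1; have : q = 1 by lra.
  by rewrite l0 => ->; lra.
have := ler_wpM2l (ltW l0) (test l^-1).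
have -> : l * (q * (q - 1) + 2 * l^-1 * B) = l * q * (q - 1) + 2 * B.
  by field; rewrite gt_eqF.
have -> : l * (l * (q + l^-1 ^+ 2 * B)) = l * l * q + B.
  by field; rewrite gt_eqF.
lra.
Qed.

End ExtremalGraph.

(** * Numerical estimates for the two cases *)

(** With s and t the sizes of S and U, the left side bounds the degree sum of a graph with a
    deficient pair, and the right side is the degree sum that Hong's bound demands when the spectral
    radius is at least n - r - 2. *)
Lemma deficient_pair_size (n r s t : nat) :
  1 <= r -> 4 * (r + 1) * (r + 2) <= n -> s < t -> s + t <= n -> r + 2 <= t ->
  (n - t) * (n - t).-1 + 2 * (t * s + (r * t - r * s - 1)) <
  (n - r - 1) * (n - 2 * r - 2) + n * r.
Proof.
move=> r1 hn st stn tr.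
have [b nb] : exists b, n = t + s + b by exists (n - (t + s)); lia.
have pred_sq m : m * m.-1 + m = m * m by case: m => // m; rewrite /= -mulnSr.
have := pred_sq (n - t); rewrite (_ : n - t = s + b); last by lia.
have rst : r * s + 1 <= r * t by rewrite -addn1 in st; have := leq_mul (leqnn r) st; lia.
have : r * t - r * s - 1 + 1 + r * s = r * t by lia.
have sub_mul y : (y + r + 1) * y + (3 * r + 3) * (y + 2 * r + 2) =
    (y + 2 * r + 2) * (y + 2 * r + 2) + 2 * ((r + 1) * (r + 1)).
  by lia.
have : (n - r - 1) * (n - 2 * r - 2) + (3 * r + 3) * n = n * n + 2 * ((r + 1) * (r + 1)).
  have := sub_mul (n - 2 * r - 2).
  have -> : n - 2 * r - 2 + 2 * r + 2 = n by nia.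
  by have -> : n - 2 * r - 2 + r + 1 = n - r - 1 by nia.
(* This is what remains after cancelling common terms. For t at least 4 r + 5 the square of t
   suffices, since s < t; otherwise [b] is of order 4 r^2, and (4 r + 5) t is bounded by the
   inequality of the means. *)
have key : (4 * r + 3) * t + 2 * s < 2 * (b * (t - r - 1)) + t * t + 2 * ((r + 1) * (r + 1)) + 2.
  have [t_big|t_small] := leqP (4 * r + 5) t.
    move: (b * _) (leq_mul t_big (leqnn t)) => X; lia.
  have b_big : 4 * (r * r) + 4 * r + 1 <= b by lia.
  have : b <= b * (t - r - 1) by rewrite leq_pmulr //; lia.
  have : (4 * r + 5) * t * 4 <= 4 * (t * t) + (4 * r + 5) * (4 * r + 5).
    by have := (nat_Cauchy (2 * t) (4 * r + 5)).1; rewrite -!mulnn; lia.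
  move: (b * _) => X; lia.
have : b * (t - r - 1) + b * r + b = b * t.
  have [a ->] : exists a, t = a + r + 1 by exists (t - r - 1); lia.
  by rewrite (_ : a + r + 1 - r - 1 = a); lia.
move: key; move: (b * (t - r - 1)) => Y.
move: ((n - r - 1) * (n - 2 * r - 2)) ((s + b) * (s + b).-1) (r * t - r * s - 1) => X M P.
rewrite {}nb => *; lia.
Qed.

Section Excess.
Variables (T : finType) (U : {set T}) (d : T -> nat) (r : nat).
Hypothesis (cU : #|U| = r.+1).

Lemma sum_sq_bounded_excess : 2 <= r ->
  (forall u, u \in U -> r <= d u <= 2 * r - 2) ->
  \sum_(u in U) d u <= r * (r + 1) + r - 1 ->
  \sum_(u in U) d u ^ 2 + (r - 1) <= (2 * r - 1) ^ 2 + r * r ^ 2.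
Proof.
move=> r2 hd hs.
(* (d u - r) (d u - (2 r - 2)) <= 0 *)
have : \sum_(u in U) (d u ^ 2 + r * (2 * r - 2)) <= \sum_(u in U) (3 * r - 2) * d u.
  apply: leq_sum => u /hd; nia.
rewrite big_split -[X in _ <= X -> _]big_distrr sum_nat_const cU /=.
have := leq_mul (leqnn (3 * r - 2)) hs.
move: (\sum_(u in U) _) (\sum_(u in U) _) => D D2.
(* The substitution clears the truncated subtractions. The estimate has no slack: both sides come to
   r^3 + 4 r^2 - 5 r + 2 once r - 1 is moved to the right. *)
have [a ->] : exists a, r = a + 2 by exists (r - 2); lia.
have -> : 3 * (a + 2) - 2 = 3 * a + 4 by lia.
have -> : 2 * (a + 2) - 2 = 2 * a + 2 by lia.
have -> : 2 * (a + 2) - 1 = 2 * a + 3 by lia.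
have -> : (a + 2) * (a + 2 + 1) + (a + 2) - 1 = a * a + 6 * a + 7 by lia.
by rewrite -!mulnn; lia.
Qed.

End Excess.

Section Gap.
Local Open Scope ring_scope.

(** Put g = l - q + 1 and p = r + 1. The loss of r - 1 in the sum of squares must be absorbed by g
    D, so r - 1 <= g p^2; but l >= 4 p^2 forces 16 p^4 g <= B. Hence 16 p^2 (r - 1) <= B, while B is
    only about p^3. *)
Lemma perturbation_gap (R : realType) (n r : nat) (l D2 D : R) :
  (2 <= r)%N -> (4 * (r + 1) * (r + 2) <= n)%N -> let q : R := (n - r - 1)%:R in
  let B : R := ((2 * r - 1) ^ 2 + r * r ^ 2)%:R in
  q - 1 <= l -> B <= l * q * (l - q + 1) ->
  (l - q + 1) * (l * (l + 1) - D) <= D2 -> D2 + (r - 1)%:R <= B ->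
  D <= (r * (r + 1) + r - 1)%:R -> False.
Proof.
move=> r2 hn q B ql hB hG hD2 hD.
set g := l - q + 1 in hB hG.
have g0 : 0 <= g by rewrite /g; lra.
set p : R := (r.+1)%:R.
have p3 : 3 <= p by rewrite /p ler_nat; lia.
have rp : (r - 1)%:R = p - 2 by rewrite natrB ?/p -?natr1; [ring|lia].
have lp : 4 * p ^+ 2 <= l.
  apply: le_trans ql; rewrite /q /p -natrX -natrM -(natrB _ (_ : 1 <= n - r - 1)%N) ?ler_nat; nia.
have Dp : D <= p ^+ 2.
  by apply: le_trans hD _; rewrite /p -natrX ler_nat; nia.
have Bp : B <= (p - 1) ^+ 2 * (p + 3).
  rewrite /B /p -natr1 addrK -natrX (_ : r%:R + 1 + 3 = (r + 4)%:R); last by rewrite natrD; ring.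
  by rewrite -natrM ler_nat; nia.
have l0 : 0 <= l by apply: le_trans lp; rewrite mulr_ge0 ?sqr_ge0.
have gl : g * (16 * p ^+ 4) <= g * (l * (l + 1) - D).
  apply: ler_wpM2l => //.
  have : (4 * p ^+ 2) * (4 * p ^+ 2) <= l * l by apply: ler_pM; rewrite ?mulr_ge0 ?sqr_ge0.
  have : p ^+ 2 <= l by apply: le_trans lp; have := sqr_ge0 p; lra.
  have -> : 4 * p ^+ 2 * (4 * p ^+ 2) = 16 * p ^+ 4 by ring.
  lra.
have key : p - 2 <= g * p ^+ 2.
  have hgD : g * D <= g * p ^+ 2 by apply: ler_wpM2l.
  have hgl : l * q * g <= g * (l * (l + 1)).
    rewrite mulrC; apply: ler_wpM2l => //; apply: ler_wpM2l => //; lra.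
  move: hG; rewrite mulrBr; lra.
have : (p - 2) * (16 * p ^+ 2) <= (p - 1) ^+ 2 * (p + 3).
  apply: (@le_trans _ _ (g * p ^+ 2 * (16 * p ^+ 2))).
    by rewrite ler_wpM2r // mulr_ge0 ?sqr_ge0.
  have -> : g * p ^+ 2 * (16 * p ^+ 2) = g * (16 * p ^+ 4) by ring.
  by apply: le_trans gl _; rewrite rp in hD2; lra.
nra.
Qed.

End Gap.

(** * Embedding into the extremal graph, and rigidity *)

Section Embedding.
Variables (T : finType) (G : sgraph T) (n r : nat) (S U : {set T}) (w : T).
Hypothesis cT : #|T| = n.
Hypotheses (r_gt0 : 0 < r) (rn : 3 * r <= n).
Hypotheses (cS : #|S| = r) (cU : #|U| = r.+1) (dSU : [disjoint S & U]) (wU : w \in U).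
Hypothesis (Uout : forall u v, u \in U -> u != w -> v \notin S -> ~~ G u v).
Hypothesis (wout : #|[set v in ~: S | G w v]| = r - 1).

(** Edges of G at [U] lead to [S], or join [w] to its r - 1 other neighbours; F has all of these
    once the vertices are matched, and outside [U] it is a clique. *)
Lemma embed_in_F : exists2 psi : F_vertex n r -> T, bijective psi &
  forall a b, G (psi a) (psi b) -> F_graph n r a b.
Proof.
pose N := [set v in ~: S | G w v].
have NS : {in N, forall v, v \notin S} by move=> v; rewrite !inE => /andP[].
have US : {in U, forall v, v \notin S}.
  by move=> v vU; apply: contraTN dSU => vS; apply/pred0Pn; exists v; rewrite /= vS.
have NU : {in N, forall v, v \notin U}.
  move=> v; rewrite !inE => /andP[vS Gwv]; apply: contraTN Gwv => vU.
  have [->|vw] := eqVneq v w; first by rewrite adj_irr.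
  by rewrite adj_sym Uout // US.
(* The order is that of the vertices of F: the r - 1 neighbours of [w] come first in the middle
   clique, and [w] takes the place of the vertex [ord0]. *)
pose l := enum S ++ (enum N ++ enum (~: (S :|: N :|: U))) ++ (w :: enum (U :\ w)).
have count1 v : count_mem v l = 1.
  rewrite /l !count_cat /= !count_uniq_mem ?enum_uniq // !mem_enum !in_setC !in_setU in_setD1 eq_sym.
  have [vS|vS] := boolP (v \in S).
    have vU : v \in U = false by apply: contraTF vS => /US.
    have vN : v \in N = false by apply: contraTF vS => /NS.
    have vw : v == w = false by apply: contraTF wU => /eqP <-; rewrite vU.
    by rewrite vU vN vw.
  have [vN|vN] := boolP (v \in N).
    have vU : v \in U = false by apply: contraTF vN => vU; apply: contraTN vU => /NU.
    have vw : v == w = false by apply: contraTF wU => /eqP <-; rewrite vU.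
    by rewrite vU vw.
  have [vU|vU] := boolP (v \in U); first by case: (v == w).
  have vw : v == w = false by apply: contraNF vU => /eqP ->.
  by rewrite vw.
have lmem v : v \in l by rewrite -has_pred1 has_count count1.
have lu : uniq l by apply: count_mem_uniq => v; rewrite lmem count1.
have sl : size l = n by rewrite -cT -(card_uniqP lu); apply: eq_card => v; rewrite lmem.
have sS : size (enum S) = r by rewrite -cardE.
have sN : size (enum N) = r - 1 by rewrite -cardE.
have sU : size (enum (U :\ w)) = r.
  by rewrite -cardE; have := cardsD1 w U; rewrite wU cU => -[].
have sQ : size (enum (~: (S :|: N :|: U))) = n - 2 * r - 1 - (r - 1).
  by move: sl; rewrite /l !size_cat /= sS sN sU; lia.
pose idx (a : F_vertex n r) : nat := match a with
  | inl i => i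
  | inr (inl j) => r + j
  | inr (inr k) => n - r - 1 + k
  end.
have idx_lt a : idx a < n by case: a => [[i ?]|[[j ?]|[k ?]]] /=; lia.
have idx_inj : injective idx.
  case=> [[i ?]|[[j ?]|[k ?]]] [[i' ?]|[[j' ?]|[k' ?]]] /= E; try by lia.
  - by congr inl; apply/eqP; rewrite -val_eqE /= E.
  - by congr (inr (inl _)); apply/eqP; rewrite -val_eqE /=; lia.
  - by congr (inr (inr _)); apply/eqP; rewrite -val_eqE /=; lia.
pose psi a := nth w l (idx a).
have psi_inj : injective psi.
  by move=> a b /eqP; rewrite nth_uniq ?sl // => /eqP /idx_inj.
have psi_indep (k : 'I_r.+1) : psi (inr (inr k)) = nth w (w :: enum (U :\ w)) k.
  rewrite /psi /l nth_cat sS ifN; last by rewrite /=; lia.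
  rewrite nth_cat size_cat sN sQ ifN; last by rewrite /=; lia.
  by congr (nth _ _ _) => /=; lia.
have psi_indepU (k : 'I_r.+1) : psi (inr (inr k)) \in U.
  rewrite psi_indep; have : nth w (w :: enum (U :\ w)) k \in w :: enum (U :\ w).
    by apply: mem_nth; rewrite /= sU.
  by rewrite inE mem_enum in_setD1 => /orP[/eqP->|/andP[]].
have psi_indepw (k : 'I_r.+1) : psi (inr (inr k)) = w -> k = ord0.
  rewrite psi_indep; case: k => -[|k] kr /= E; first exact: val_inj.
  have : nth w (enum (U :\ w)) k \in enum (U :\ w) by apply: mem_nth; rewrite sU.
  by rewrite E mem_enum !inE eqxx.
have psi_Q (j : 'I_(n - 2 * r - 1)) :
    psi (inr (inl j)) = nth w (enum N ++ enum (~: (S :|: N :|: U))) j.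
  have jn := ltn_ord j.
  rewrite /psi /l nth_cat sS ifN; last by rewrite /=; lia.
  rewrite nth_cat size_cat sN sQ ifT; last by rewrite /=; lia.
  by congr (nth _ _ _) => /=; lia.
have psi_QS (j : 'I_(n - 2 * r - 1)) : psi (inr (inl j)) \notin S.
  have jn := ltn_ord j; rewrite psi_Q.
  have : nth w (enum N ++ enum (~: (S :|: N :|: U))) j \in enum N ++ enum (~: (S :|: N :|: U)).
    by apply: mem_nth; rewrite size_cat sN sQ; lia.
  rewrite mem_cat !mem_enum => /orP[/NS//|].
  by rewrite !inE !negb_or -andbA => /andP[].
have psi_QN (j : 'I_(n - 2 * r - 1)) : psi (inr (inl j)) \in N -> j < r - 1.
  have jn := ltn_ord j; rewrite psi_Q nth_cat sN; case: ltnP => // rj.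
  have : nth w (enum (~: (S :|: N :|: U))) (j - (r - 1)) \in enum (~: (S :|: N :|: U)).
    by apply: mem_nth; rewrite sQ; lia.
  by rewrite mem_enum in_setC !in_setU !negb_or -andbA => /and3P[_ /negbTE ->].
have indepP k b : G (psi (inr (inr k))) (psi b) -> F_graph n r (inr (inr k)) b.
  rewrite F_adj_indep; have kU := psi_indepU k.
  have outw v : v \notin S -> G (psi (inr (inr k))) v -> psi (inr (inr k)) = w.
    by move=> vS; apply: contraTeq => uw; apply: Uout.
  case: b => [i|[j|k']] // Gkb.
    have kw := outw _ (psi_QS j) Gkb; rewrite (psi_indepw _ kw) eqxx /=; apply: psi_QN.
    by rewrite inE in_setC psi_QS -kw.
  have k'U := psi_indepU k'; have kw := outw _ (US _ k'U) Gkb.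
  move: Gkb; rewrite kw; have [->|k'w] := eqVneq (psi (inr (inr k'))) w; first by rewrite adj_irr.
  by rewrite adj_sym (negbTE (Uout k'U k'w (US _ wU))).
exists psi.
  by apply: inj_card_bij => //; rewrite !card_sum !card_ord cT; lia.
move=> a b; case: (boolP (a \in F_indep n r)) => [|aQ].
  by case: a => [i|[j|k]]; rewrite inE // => _; exact: indepP.
case: (boolP (b \in F_indep n r)) => [|bQ].
  by case: b => [i|[j|k]]; rewrite inE // => _; rewrite adj_sym => /indepP; rewrite adj_sym.
rewrite (F_clique (_ : a \in ~: F_indep n r) (_ : b \in ~: F_indep n r)) ?in_setC //.
by apply: contraTneq => ->; rewrite adj_irr.
Qed.

End Embedding.

(** The eigenvector of G is positive by connectedness. Carried over to H, it would give a Rayleigh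
    quotient above the spectral radius of G if H had an additional edge. *)
Lemma spectral_radius_rigid (R : realType) (T V : finType) (G : sgraph T) (H : sgraph V)
    (psi : V -> T) :
  connected_graph G -> bijective psi -> (forall a b, G (psi a) (psi b) -> H a b) ->
  (spectral_radius H R <= spectral_radius G R)%R ->
  forall a b, H a b = G (psi a) (psi b).
Proof.
move=> [T0 Gconn] psi_bij GH Hle a b.
have [[x [[v0 xv0] x0 xlam]] _] := spectral_radiusP R G T0.
have x_gt0 v : (0 < x v)%R.
  rewrite lt_def x0 andbT; apply: contraNN xv0 => xv.
  (* A zero entry forces zeros at all neighbours, and so along a path to the nonzero entry at
     [v0]. *)
  have /connectP[p] := Gconn v v0; elim: p v xv => [|u p IHp] v xv /=; first by move=> _ ->.
  move=> /andP[Gvu pth]; apply: IHp => //.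
  have : (\sum_u (G v u)%:R * x u = 0)%R by rewrite xlam (eqP xv) mulr0.
  move=> /psumr_eq0P h; have /eqP := h (fun u _ => mulr_ge0 (ler0n _ _) (x0 u)) u isT.
  by rewrite Gvu mul1r.
have V0 : 0 < #|V| by apply/card_gt0P; exists a.
have [_ /(_ (x \o psi))] := spectral_radiusP R H V0.
rewrite /graph_form /= => hH.
pose y i j : R := (((H i j)%:R - (G (psi i) (psi j))%:R) * x (psi i) * x (psi j))%R.
have y0 i j : (0 <= y i j)%R.
  rewrite /y !mulr_ge0 // subr_ge0 ler_nat.
  by case E : (G (psi i) (psi j)) => //; rewrite (GH _ _ E).
have G_form : (\sum_i \sum_j (G (psi i) (psi j))%:R * x (psi i) * x (psi j) =
    spectral_radius G R * \sum_i x (psi i) ^+ 2)%R.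
  rewrite mulr_sumr; apply: eq_bigr => i _.
  rewrite expr2 mulrA -xlam mulr_suml (reindex _ (onW_bij _ psi_bij)) /=.
  by apply: eq_bigr => j _; rewrite mulrAC.
have : (\sum_i \sum_j y i j <= 0)%R.
  under eq_bigr => i _ do under eq_bigr => j _ do rewrite /y !mulrBl.
  under eq_bigr => i _ do rewrite sumrB.
  rewrite sumrB G_form subr_le0; apply: le_trans hH _; apply: ler_wpM2r => //.
  by apply: sumr_ge0 => i _; exact: sqr_ge0.
move=> ysum; have : (\sum_i \sum_j y i j = 0)%R.
  by apply/eqP; rewrite eq_le ysum sumr_ge0 // => i _; apply: sumr_ge0.
move/psumr_eq0P => /(_ (fun i _ => sumr_ge0 _ (fun j _ => y0 i j)) a isT).
move/psumr_eq0P => /(_ (fun j _ => y0 a j) b isT) /eqP.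
rewrite /y -mulrA mulf_eq0 (gt_eqF (mulr_gt0 (x_gt0 _) (x_gt0 _))) orbF subr_eq0 eqr_nat.
by case: (H a b); case: (G _ _).
Qed.

(** * From a deficient pair to the extremal graph *)

Theorem theorem5p4 (R : realType) (r n : nat) (T : finType) (G : sgraph T)
  (hr : (1 <= r)%N) (hn : #|T| = n) (hn_large : (4 * (r + 1) * (r + 2) <= n)%N)
  (hconn : connected_graph G) (hdeg : (r <= min_degree G)%N)
  (hlambda : (spectral_radius (F_graph n r) R <= spectral_radius G R)%R) :
  has_fractional_factor G R r \/ isomorphic G (F_graph n r).
Proof.
have [|[S [U [dSU hSU]]]] := fractional_factor_or_deficient_pair G R r; first by left.
right; set l := spectral_radius G R in hlambda.
have T0 : 0 < #|T| by case: hconn.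
have dr v : r <= degree G v := leq_trans hdeg (min_degree_le G v).
have rn : 3 * r <= n by nia.
pose out u := \sum_(w in ~: S) G u w.
have deg_le u : degree G u <= #|S| + out u.
  rewrite degree_sum (bigID (mem S)) /=; apply: leq_add.
    by rewrite -sum1_card; apply: leq_sum => w _; exact: leq_b1.
  by rewrite /out [leqRHS](eq_bigl (fun w => w \notin S)) // => w; rewrite inE.
pose D := \sum_(u in U) degree G u; pose O := \sum_(u in U) out u.
have DO : D <= #|U| * #|S| + O.
  by rewrite -sum_nat_const -big_split; apply: leq_sum.
have Dr : #|U| * r <= D by rewrite -sum_nat_const; apply: leq_sum.
rewrite -/O in hSU.
have stn : #|S| + #|U| <= n.
  by rewrite -hn -cardsUI (disjoint_setI0 dSU) cards0 addn0 max_card.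
have cUC : #|~: U| = n - #|U| by rewrite cardsCs setCK hn.
have st : #|S| < #|U| by rewrite -(ltn_pmul2l hr); lia.
have rt : r < #|U|.
  (* The bounds on [D] and [O] combine to r |S| < |U| |S|, which |U| <= r excludes. *)
  rewrite ltnNge; apply/negP => tr.
  have := leq_mul tr (leqnn #|S|); lia.
have [ql hB] := spectral_radius_F_ge hr rn hlambda.
have [tr2|tr2] := leqP (r + 2) #|U|.
  have := deficient_pair_size hr hn_large st stn tr2; rewrite ltnNge => /negP[].
  have q1 : ((n - r - 1)%:R - 1 - r%:R = (n - 2 * r - 2)%:R :> R)%R.
    rewrite -(natrB _ (_ : 1 <= n - r - 1)) -?natrB; try by lia.
    by congr (_%:R)%R; lia.
  have hong := spectral_radius_hong R T0 dr; rewrite -/l hn in hong.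
  have : ((n - r - 1) * (n - 2 * r - 2) + n * r <= \sum_v degree G v)%N.
    rewrite -(ler_nat R) natrD natrM -lerBrDr; apply: le_trans hong.
    by apply: ler_pM; rewrite ?ler0n // -?q1; lra.
  move=> /leq_trans -> //; apply: leq_trans (sum_degree_le G U) _; rewrite cUC -/D.
  by lia.
have cU : #|U| = r.+1 by lia.
have cq : #|~: U| = n - r - 1 by rewrite cUC cU; lia.
have D_le : D <= r * (r + 1) + #|S| - 1 by move: DO hSU; rewrite cU; nia.
(* The threshold 2 r - 1 is the degree in F of the vertex that receives the added edges. *)
have [/existsP[w /andP[wU dw]]|] := boolP [exists w in U, 2 * r - 1 <= degree G w]; last first.
  rewrite negb_exists => /forallP hU; exfalso.
  have {}hU u : u \in U -> degree G u <= 2 * r - 2.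
    by move=> uU; have := hU u; rewrite uU -ltnNge; lia.
  (* Degrees between r and 2 r - 2 exist only if r is at least 2. *)
  have r2 : 2 <= r.
    have [u uU] : exists u, u \in U by apply/card_gt0P; rewrite cU.
    by have := hU u uU; have := dr u; lia.
  apply: (@perturbation_gap R n r l (\sum_(u in U) (degree G u)%:R ^+ 2)%R
    (\sum_(u in U) (degree G u)%:R)%R r2 hn_large ql hB).
  - rewrite -cq; apply: (spectral_radius_sparse_set _ hU); rewrite ?cq //; first by lia.
    apply: lt_le_trans ql; rewrite -(natrB _ (_ : 1 <= n - r - 1)) ?ltr_nat; nia.
  - under eq_bigr do rewrite -natrX.
    rewrite -natr_sum -natrD ler_nat; apply: sum_sq_bounded_excess => //.
      by move=> u uU; rewrite dr hU.
    by rewrite -/D; lia.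
  - by rewrite -natr_sum ler_nat -/D; lia.
(* Together with [D_le] and |S| < |U| = r + 1, this forces |S| = r. *)
have D_ge : r * r + (2 * r - 1) <= D.
  rewrite /D (bigD1 w) //= addnC; apply: leq_add => //.
  have -> : r * r = \sum_(u in U :\ w) r.
    by rewrite sum_nat_const; congr (_ * _); have := cardsD1 w U; rewrite wU cU => -[].
  rewrite [leqRHS](eq_bigl (fun u => u \in U :\ w)); last by move=> u; rewrite !inE andbC.
  by apply: leq_sum.
have cS : #|S| = r by lia.
(* With |S| = r the deficiency allows only r - 1 edge ends from [U] out of [S], and [w] already uses
   them all. *)
have O_le : O <= r - 1 by move: hSU; rewrite cU cS; nia.
have O_w : O = out w + \sum_(u in U | u != w) out u by rewrite /O (bigD1 w).
have out_w : r - 1 <= out w by have := deg_le w; rewrite cS; lia.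
have out0 u : u \in U -> u != w -> out u = 0.
  move=> uU uw; have : \sum_(u in U | u != w) out u = 0 by lia.
  by move/eqP; rewrite sum_nat_eq0 => /forall_inP/(_ u); rewrite uU uw => /(_ isT)/eqP.
have [psi psi_bij psiF] : exists2 psi : F_vertex n r -> T, bijective psi &
    forall a b, G (psi a) (psi b) -> F_graph n r a b.
  apply: (@embed_in_F T G n r S U w) => //.
    move=> u v uU uw vS; have /eqP := out0 u uU uw.
    by rewrite /out sum_nat_eq0 => /forall_inP/(_ v); rewrite inE vS eqb0 => /(_ isT).
  have -> : #|[set v in ~: S | G w v]| = out w.
    rewrite /out -sum1dep_card big_mkcondr; apply: eq_bigr => v _; by case: (G w v).
  lia.
have FG := spectral_radius_rigid hconn psi_bij psiF hlambda.
have [phi psiK phiK] := psi_bij.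
exists phi; first by exists psi.
by move=> x y; rewrite FG !phiK.
Qed.
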